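(* Let $H$ be a $2$-connected framework for a $3$-connected matroid $N$. If $N$ is representable (over some field), then $H$ is a frame representation or a lifted-graphic representation of $N$.
   Context: Graphs may have loops and parallel edges. A graph $H$ is a framework for a matroid $N$ if (QG1) $E(H)=E(N)$; (QG2) $r_N(E(H'))\le |V(H')|$ for each component $H'$ of $H$; (QG3) for each vertex $v$, $\mathrm{cl}_N(E(H-v))\subseteq E(H-v)\cup \mathrm{loops}_H(v)$, where $\mathrm{loops}_H(v)$ is the set of loops at $v$; (QG4) for each circuit $C$ of $N$, $H[C]$ has at most two components. A cycle of $H$ is balanced if its edge set is a circuit of $N$, unbalanced otherwise. $H$ is a frame representation of $N$ if a set $I\subseteq E(H)$ is independent in $N$ iff $H[I]$ has no balanced cycle and each component $H'$ of $H[I]$ satisfies $|E(H')|\le |V(H')|$. $H$ is a lifted-graphic representation of $N$ if $I\subseteq E(H)$ is independent in $N$ iff $H[I]$ has at most one cycle and that cycle, if it exists, is unbalanced. A graph $G$ is $k$-connected if $G-S$ has exactly one component for every $S\subset V(G)$ with $|S|<k$. *)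

(* Defs.v *)
From HB Require Import structures.
From mathcomp Require Import all_boot all_order all_algebra.

Set Implicit Arguments.
Unset Strict Implicit.
Unset Printing Implicit Defensive.

(* A finite matroid whose ground set is the whole type E. *)
Record matroid (E : finType) := Matroid {
  indep : pred {set E};
  indep0 : indep set0;
  indepS : forall I J : {set E}, I \subset J -> indep J -> indep I;
  indep_aug : forall I J : {set E}, indep I -> indep J -> #|I| < #|J| ->
    exists2 e, e \in J :\: I & indep (e |: I)
}.

Section MatroidDefs.
Variables (E : finType) (N : matroid E).

Definition rank (X : {set E}) : nat :=
  \max_(I : {set E} | (I \subset X) && indep N I) #|I|.

Definition closure (X : {set E}) : {set E} :=
  [set e | rank (e |: X) == rank X].

Definition circuit (C : {set E}) : bool := minset (fun D => ~~ indep N D) C.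

(* Tutte k-connectivity: there is no j-separation with 0 < j < k, a
   j-separation being a partition (X, ~: X) with both sides of size at least j
   and r(X) + r(~: X) - r(E) < j. *)
Definition matroid_connected (k : nat) : Prop :=
  forall (j : nat) (X : {set E}), 0 < j < k -> j <= #|X| -> j <= #|~: X| ->
    rank [set: E] + j <= rank X + rank (~: X).

(* [free] is linear independence of a family: elements represented by equal
   vectors are dependent. *)
Definition representable_over (F : fieldType) : Prop :=
  exists (n : nat) (v : E -> 'rV[F]_n),
    forall I : {set E}, indep N I <-> free [seq v e | e <- enum I].

Definition representable : Prop :=
  exists F : fieldType, representable_over F.

End MatroidDefs.

(* Loops and parallel edges are allowed: a loop is an edge with a single end.
   Vertices and edges live in ambient types, so that subgraphs of a graph have
   the same type; [ends] is irrelevant outside [edges]. *)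
Record graph (V E : finType) := Graph {
  vertices : {set V};
  edges : {set E};
  ends : E -> {set V};
  ends_sub : forall e, e \in edges -> ends e \subset vertices;
  ends_card : forall e, e \in edges -> 0 < #|ends e| <= 2
}.

Section GraphDefs.
Variables V E : finType.
Implicit Types (G : graph V E) (K S : {set V}) (X C : {set E}) (u v : V).

Section Induced.
Variables (G : graph V E) (K : {set V}).
Let vs := vertices G :&: K.
Let es := [set e in edges G | ends G e \subset K].

Fact induced_sub e : e \in es -> ends G e \subset vs.
Proof. by rewrite inE subsetI => /andP[/ends_sub -> ->]. Qed.

Fact induced_card e : e \in es -> 0 < #|ends G e| <= 2.
Proof. by rewrite inE => /andP[/ends_card]. Qed.

Definition induced : graph V E := Graph induced_sub induced_card.
End Induced.

Definition del_vertices G S : graph V E := induced G (~: S).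

(* G[X]: the edges in X together with their ends, without isolated vertices. *)
Section EdgeSubgraph.
Variables (G : graph V E) (X : {set E}).
Let es := edges G :&: X.
Let vs := \bigcup_(e in es) ends G e.

Fact edge_subgraph_sub e : e \in es -> ends G e \subset vs.
Proof. by move=> eX; apply: bigcup_sup. Qed.

Fact edge_subgraph_card e : e \in es -> 0 < #|ends G e| <= 2.
Proof. by rewrite inE => /andP[/ends_card]. Qed.

Definition edge_subgraph : graph V E :=
  Graph edge_subgraph_sub edge_subgraph_card.
End EdgeSubgraph.

Definition loops G v : {set E} := [set e in edges G | ends G e == [set v]].

Definition adjacent G : rel V :=
  [rel u v | [exists e in edges G, (u \in ends G e) && (v \in ends G e)]].

(* The vertex sets of the components; the component itself on the vertex set K
   is [induced G K]. *)
Definition components G : {set {set V}} :=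
  equivalence_partition (connect (adjacent G)) (vertices G).

Definition graph_connected (k : nat) G : Prop :=
  forall S : {set V}, S \proper vertices G -> #|S| < k ->
    #|components (del_vertices G S)| = 1.

(* A loop contributes 2 to the degree of its end. *)
Definition degree G v : nat :=
  #|[set e in edges G | v \in ends G e]| + #|loops G v|.

(* C is the edge set of a cycle, i.e. of a connected 2-regular subgraph: a loop,
   two parallel edges, or a longer polygon. *)
Definition cycle_of G C : Prop :=
  [/\ C \subset edges G, #|components (edge_subgraph G C)| = 1
    & forall v, v \in vertices (edge_subgraph G C) ->
        degree (edge_subgraph G C) v = 2].

End GraphDefs.

Section FrameworkDefs.
Variables (V E : finType) (H : graph V E) (N : matroid E).

Record framework : Prop := Framework {
  QG1 : edges H = [set: E];
  QG2 : forall K, K \in components H ->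
    rank N (edges (induced H K)) <= #|vertices (induced H K)|;
  QG3 : forall v, v \in vertices H ->
    closure N (edges (del_vertices H [set v]))
      \subset edges (del_vertices H [set v]) :|: loops H v;
  QG4 : forall C : {set E}, circuit N C ->
    #|components (edge_subgraph H C)| <= 2
}.

(* Only meaningful for the edge set C of a cycle of H. *)
Definition balanced (C : {set E}) : bool := circuit N C.

Definition frame_representation : Prop :=
  forall I : {set E}, I \subset edges H ->
    (indep N I <->
      (forall C, cycle_of (edge_subgraph H I) C -> ~~ balanced C) /\
      (forall K, K \in components (edge_subgraph H I) ->
         #|edges (induced (edge_subgraph H I) K)|
           <= #|vertices (induced (edge_subgraph H I) K)|)).

Definition lifted_graphic_representation : Prop :=
  forall I : {set E}, I \subset edges H ->
    (indep N I <->
      (forall C D, cycle_of (edge_subgraph H I) C ->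
         cycle_of (edge_subgraph H I) D -> C = D) /\
      (forall C, cycle_of (edge_subgraph H I) C -> ~~ balanced C)).

End FrameworkDefs.

(* Main.v *)
Require Import Defs.
From HB Require Import structures.
From mathcomp Require Import all_boot all_order all_algebra.
From mathcomp Require Import zify.

(** Represent [N] by vectors [a e], and pass to the field [F(t)]. By (QG3), for
    every vertex [v] there is a functional that vanishes on the edges avoiding
    [v] and is nonzero on every non-loop edge at [v]; let [beta e v] be its value
    at [a e]. With columns indexed by edges, [beta] has the support of the
    incidence matrix of [H] (up to loops), and its row space is contained in
    that of the representation [a]. As [H] is
    connected, [beta] has rank at least [|V| - 1], while (QG2) bounds the rank
    of [N] by [|V|].

    If the two ranks agree, [beta] represents [N], and counting the edge ends in
    a circuit shows that [H] is a frame representation. Otherwise a nowhere zero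
    vector [y] annihilates [beta]; scaling by [y] turns [beta] into a signed
    incidence matrix of [H], so that [N] is an elementary lift of the cycle
    matroid of [H]. *)

Set Implicit Arguments.
Unset Strict Implicit.
Unset Printing Implicit Defensive.
Import GRing.Theory.
Local Open Scope ring_scope.

(** * Linear relations *)

Section ExtendByZero.
Variables (T : finType) (F : fieldType) (S : {set T}) (u : 'rV[F]_#|S|).

(** The sum has one term when [x] lies in [S] and none otherwise; in this form no membership proof
    is required to turn [x] into an index. *)
Definition extend0 x : F := \sum_(i : 'I_#|S| | enum_val i == x) u 0 i.

Lemma extend0_enum_val i : extend0 (enum_val i) = u 0 i.
Proof.
by rewrite /extend0 (big_pred1 i) // => j; apply: (inj_eq enum_val_inj).
Qed.

Lemma extend0_notin x : x \notin S -> extend0 x = 0.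
Proof.
move=> xS; rewrite /extend0 big1 // => j /eqP jx.
by rewrite -jx enum_valP in xS.
Qed.

End ExtendByZero.

Section LinearRelations.
Variables (E : finType) (F : fieldType) (n : nat).
Implicit Types (a : E -> 'rV[F]_n) (S : {set E}) (l : E -> F).

Definition rows_mx a S : 'M[F]_(#|S|, n) := \matrix_(i < #|S|) a (enum_val i).

Lemma rows_mx_sub m a S (B : 'M_(m, n)) :
  (forall e, e \in S -> (a e <= B)%MS) -> (rows_mx a S <= B)%MS.
Proof.
move=> aB; apply/row_subP => i; rewrite rowK; apply: aB; exact: enum_valP.
Qed.

Lemma row_rows_mx a S e : e \in S -> (a e <= rows_mx a S)%MS.
Proof.
move=> eS; rewrite -(enum_rankK_in eS eS).
by rewrite -[a _](rowK (fun i => a (enum_val i))) row_sub.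
Qed.

Lemma mul_rows_mx a S (u : 'rV_#|S|) :
  u *m rows_mx a S = \sum_i u 0 i *: a (enum_val i).
Proof. by rewrite mulmx_sum_row; apply: eq_bigr => i _; rewrite rowK. Qed.

(** Relations are functions on the whole ground set, zero off [S], so that relations on different
    edge sets can be added and compared. *)
Lemma exists_rows_relation a S : ~~ row_free (rows_mx a S) ->
  exists l, [/\ exists e, l e != 0, forall e, l e != 0 -> e \in S
    & \sum_e l e *: a e = 0].
Proof.
rewrite -kermx_eq0 => /rowV0Pn[u /sub_kermxP u0 unz].
exists (extend0 u); split.
- by case/rV0Pn: unz => i ui; exists (enum_val i); rewrite extend0_enum_val.
- by move=> e; apply: contraNT => /extend0_notin->.
rewrite (bigID (mem S)) /= [X in _ + X]big1 => [|e /extend0_notin->]; last first.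
  by rewrite scale0r.
rewrite addr0 big_enum_val -[RHS]u0 mul_rows_mx.
by apply: eq_bigr => j _; rewrite extend0_enum_val.
Qed.

Lemma row_free_rows_mxP a S :
  reflect (forall l, (forall e, l e != 0 -> e \in S) ->
             \sum_e l e *: a e = 0 -> forall e, l e = 0)
          (row_free (rows_mx a S)).
Proof.
apply: (iffP idP) => [frS l lS l0 e | frS].
  have : (\row_i l (@enum_val _ (mem S) i)) *m rows_mx a S = 0 *m rows_mx a S.
    rewrite mul0mx mul_rows_mx -[RHS]l0 (bigID (mem S)) /= [X in _ + X]big1.
      rewrite addr0 [RHS]big_enum_val; by apply: eq_bigr => i _; rewrite mxE.
    move=> f fS; rewrite (_ : l f = 0) ?scale0r //.
    by apply/eqP; apply: contraNT fS => /lS.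
  move/(row_free_inj frS)/rowP => u0.
  apply/eqP/negPn/negP => le; have eS := lS _ le.
  have:= u0 (enum_rank_in eS e); rewrite !mxE enum_rankK_in // => le0.
  by rewrite le0 eqxx in le.
apply: contraT => /exists_rows_relation[l [[e le] lS l0]].
by rewrite (frS l) ?eqxx in le.
Qed.

End LinearRelations.

(** A homogeneous system with more unknowns than equations: [#|S|] rows of length [#|T|] are
    dependent. *)
Lemma exists_relation (E V : finType) (F : fieldType) (beta : E -> V -> F)
    (S : {set E}) (T : {set V}) : (#|T| < #|S|)%N ->
  exists l : E -> F, [/\ exists e, l e != 0, forall e, l e != 0 -> e \in S
    & forall v, v \in T -> \sum_e l e * beta e v = 0].
Proof.
move=> ltTS; pose b e := \row_(j < #|T|) beta e (enum_val j).
have : ~~ row_free (rows_mx b S).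
  by rewrite /row_free neq_ltn (leq_ltn_trans (rank_leq_col _) ltTS).
case/exists_rows_relation => l [lnz lS l0]; exists l; split=> // v vT.
have /rowP/(_ (enum_rank_in vT v)) := l0; rewrite summxE mxE => l0v.
by rewrite -[RHS]l0v; apply: eq_bigr => e _; rewrite !mxE enum_rankK_in.
Qed.

(** * Rank and closure of a represented matroid *)

Section MatroidRank.
Variables (E : finType) (N : matroid E) (F : fieldType) (n : nat).
Variable a : E -> 'rV[F]_n.
Hypothesis aN : forall I, indep N I = row_free (rows_mx a I).

(** Independent subsets give independent rows, whence one inequality. For the other, [maxrankfun]
    selects rows forming a basis of the row space, and their labels form an independent set. *)
Lemma rank_rows_mx X : rank N X = \rank (rows_mx a X).
Proof.
apply/eqP; rewrite eqn_leq; apply/andP; split.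
  apply/bigmax_leqP => I /andP[IX]; rewrite aN => /eqP <-.
  by apply/mxrankS/rows_mx_sub => e eI; apply/row_rows_mx/(subsetP IX).
pose f := maxrankfun (rows_mx a X).
pose g i : E := enum_val (f i).
have g_inj : injective g by move=> i j /enum_val_inj/maxrankfun_inj.
pose I := [set g i | i in 'I_(\rank (rows_mx a X))].
have cI : #|I| = \rank (rows_mx a X) by rewrite card_imset // card_ord.
rewrite -[leqLHS]cI; apply: (leq_bigmax_cond (P := fun I => _ && _)).
apply/andP; split; first by apply/subsetP=> _ /imsetP[i _ ->]; apply: enum_valP.
rewrite aN /row_free eqn_leq rank_leq_row /= [leqLHS]cI.
apply: mxrankS; rewrite -(eq_maxrowsub (rows_mx a X)).
apply/row_subP => i; rewrite row_rowsub rowK; apply: row_rows_mx.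
by apply/imsetP; exists i.
Qed.

(** Contraposed and combined with (QG3), this puts the vector of a non-loop edge at [v] outside the
    span of the edges avoiding [v]. *)
Lemma closure_span X e : (a e <= rows_mx a X)%MS -> e \in Defs.closure N X.
Proof.
move=> aX; rewrite inE !rank_rows_mx eqn_leq; apply/andP; split; apply: mxrankS;
  apply: rows_mx_sub => f.
- by rewrite in_setU1 => /predU1P[->//|fX]; apply: row_rows_mx.
- by move=> fX; apply: row_rows_mx; rewrite in_setU1 fX orbT.
Qed.

End MatroidRank.

Lemma free_rows_mx (E : finType) (F : fieldType) n (a : E -> 'rV[F]_n)
  (I : {set E}) : free [seq a e | e <- enum I] = row_free (rows_mx a I).
Proof.
have sz : size [seq a e | e <- enum I] == #|I| by rewrite size_map cardE.
pose t := Tuple sz.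
have tE (i : 'I_#|I|) : t`_i = a (enum_val i).
  by rewrite /= (nth_map (enum_default i)) // -cardE.
apply/(@freeP _ _ _ t)/idP => [fr|frI k k0 i].
  apply: inj_row_free => u; rewrite mul_rows_mx => u0.
  apply/rowP => i; rewrite mxE; apply: fr; rewrite -[RHS]u0.
  by apply: eq_bigr => j _; rewrite tE.
have : (\row_i k i) *m rows_mx a I = 0 *m rows_mx a I.
  rewrite mul0mx mul_rows_mx -[RHS]k0; apply: eq_bigr => j _.
  by rewrite tE mxE.
by move/(row_free_inj frI)/rowP/(_ i); rewrite !mxE.
Qed.

(** Field homomorphisms preserve rank, so the matroid stays represented after passing to a larger
    field. *)
Lemma row_free_map_rows (E : finType) (F K : fieldType) (f : {rmorphism F -> K})
    n (a : E -> 'rV[F]_n) (S : {set E}) :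
  row_free (rows_mx (fun e => map_mx f (a e)) S) = row_free (rows_mx a S).
Proof.
rewrite /row_free -(mxrank_map f); congr (\rank _ == _).
by apply/matrixP => i j; rewrite !mxE.
Qed.

(** * Comparing the ranks of the representation and of the incidence-like matrix *)

Section Dichotomy.
Variables (E V : finType) (F : fieldType) (n : nat).
Variables (a : E -> 'rV[F]_n) (w : V -> 'cV[F]_n) (T : {set V}).
Let beta e v := (a e *m w v) 0 0.
Hypothesis rank_le : (\rank (rows_mx a setT) <= #|T|)%N.
Hypothesis null_zero : forall y : V -> F,
  (forall e, \sum_(v in T) y v * beta e v = 0) ->
  forall u v, u \in T -> v \in T -> y u = 0 -> y v = 0.

(** With [B = A *m W], every relation of [A] is one of [B]. If the ranks agree, the converse holds
    too. Otherwise [B] has rank below [#|T|], so its columns are annihilated by a nonzero [y]; by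
    [null_zero] such a [y] is nowhere zero and unique up to scaling. Hence [B] has rank at least
    [#|T| - 1], and the relations of [A] have codimension at most 1 among those of [B]. *)
Lemma relation_dichotomy :
  (forall l : E -> F, (forall v, v \in T -> \sum_e l e * beta e v = 0) ->
     \sum_e l e *: a e = 0) \/
  (exists2 y : V -> F, (forall v, v \in T -> y v != 0)
      & forall e, \sum_(v in T) y v * beta e v = 0) /\
  (forall l1 l2 : E -> F,
     (forall v, v \in T -> \sum_e l1 e * beta e v = 0) ->
     (forall v, v \in T -> \sum_e l2 e * beta e v = 0) ->
     exists c1 c2 : F, (c1 != 0) || (c2 != 0) /\
       \sum_e (c1 * l1 e + c2 * l2 e) *: a e = 0).
Proof.
pose A := \matrix_(i < #|E|) a (enum_val i).
pose W := \matrix_(i < n, j < #|T|) w (enum_val j) i 0.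
pose B := A *m W.
have BE i j : B i j = beta (enum_val i) (enum_val j).
  by rewrite /beta !mxE; apply: eq_bigr => k _; rewrite !mxE.
have rA : (\rank A <= #|T|)%N.
  apply: leq_trans rank_le; apply: mxrankS; apply/row_subP => i.
  by rewrite rowK row_rows_mx ?inE.
pose L (l : E -> F) : 'rV_#|E| := \row_i l (enum_val i).
have LA l : L l *m A = \sum_e l e *: a e.
  rewrite mulmx_sum_row [RHS]big_enum_val.
  by apply: eq_bigr => i _; rewrite rowK mxE.
have LB l : (forall v, v \in T -> \sum_e l e * beta e v = 0) -> L l *m B = 0.
  move=> lb; apply/rowP => j; rewrite [RHS]mxE mxE -[RHS](lb (enum_val j)) ?enum_valP //.
  by rewrite [RHS]big_enum_val; apply: eq_bigr => i _; rewrite BE mxE.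
have kAB : (kermx A <= kermx B)%MS.
  by apply/sub_kermxP; rewrite /B mulmxA mulmx_ker mul0mx.
have rBA : (\rank B <= \rank A)%N by apply: mxrankM_maxl.
have [eqBA|ltBA] := eqVneq (\rank A) (\rank B); [left|right].
  (* Equal ranks give left kernels of equal dimension, so the inclusion [kAB] can be reversed. *)
  move=> l /LB/sub_kermxP lB; rewrite -LA; apply/sub_kermxP.
  apply: submx_trans lB _.
  by rewrite -(geq_leqif (mxrank_leqif_sup kAB)) !mxrank_ker eqBA.
have {rBA} ltBA : (\rank B < \rank A)%N by rewrite ltn_neqAle eq_sym ltBA.
have ltBT : (\rank B < #|T|)%N := leq_trans ltBA rA.
have nullP (y : 'rV_#|T|) : y *m B^T = 0 -> forall i j, y 0 i = 0 -> y 0 j = 0.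
  move=> y0 i j yi.
  have zE := extend0_enum_val y.
  rewrite -zE; apply: (null_zero _ (enum_valP i)); rewrite ?enum_valP ?zE //.
  move=> e; have /rowP/(_ (enum_rank e)) := y0; rewrite mxE [RHS]mxE => y0e.
  rewrite -[RHS]y0e [LHS]big_enum_val; apply: eq_bigr => k _.
  by rewrite zE mxE BE enum_rankK.
have : kermx B^T != 0.
  by rewrite -mxrank_eq0 mxrank_ker mxrank_tr subn_eq0 -ltnNge.
case/rowV0Pn => y /sub_kermxP y0 ynz.
have ynz' i : y 0 i != 0.
  by apply: contraNneq ynz => yi; apply/eqP/rowP => j; rewrite mxE (nullP _ y0 i).
have T0 : (0 < #|T|)%N by apply: leq_ltn_trans ltBT.
pose i0 := Ordinal T0.
(* A null vector minus the multiple of [y] agreeing with it at [i0] vanishes at [i0], hence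
   everywhere. *)
have ker1 : (\rank (kermx B^T) <= 1)%N.
  apply: leq_trans (rank_leq_row y); apply: mxrankS; apply/row_subP => i.
  set z := row i _.
  have z0 : z *m B^T = 0 by apply/sub_kermxP/row_sub.
  apply/sub_rVP; exists (z 0 i0 / y 0 i0).
  apply/eqP; rewrite -subr_eq0; apply/eqP/rowP => j; rewrite [RHS]mxE.
  apply: (nullP _ _ i0); first by rewrite mulmxBl z0 -scalemxAl y0 scaler0 subr0.
  by rewrite !mxE divfK ?subrr.
have rAB : (\rank A <= (\rank B).+1)%N.
  by move: ker1; rewrite mxrank_ker mxrank_tr; lia.
split.
  exists (extend0 y).
    by move=> v vT; rewrite -(enum_rankK_in vT vT) extend0_enum_val.
  move=> e; have /rowP/(_ (enum_rank e)) := y0; rewrite mxE [RHS]mxE => y0e.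
  rewrite -[RHS]y0e [LHS]big_enum_val; apply: eq_bigr => k _.
  by rewrite extend0_enum_val mxE BE enum_rankK.
move=> l1 l2 /LB/sub_kermxP l1B /LB/sub_kermxP l2B.
pose M := col_mx (L l1) (L l2).
have MB : (M <= kermx B)%MS by rewrite col_mx_sub l1B.
(* The part of [kermx B] killed by [A] is [kermx A], so [kermx B *m A] has rank [\rank A - \rank B],
   at most 1. The two rows of [M *m A] are therefore dependent, and a null vector [c] supplies the
   coefficients. *)
have rMA : (\rank (M *m A) <= 1)%N.
  apply: leq_trans (mxrankS (submxMr A MB)) _.
  have := mxrank_mul_ker (kermx B) A.
  by rewrite (capmx_idPr kAB) !mxrank_ker; have := rank_leq_row A; lia.
have : ~~ row_free (M *m A) by rewrite /row_free neq_ltn ltnS rMA.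
rewrite -kermx_eq0 => /rowV0Pn[c /sub_kermxP c0 cnz].
exists (c 0 (lshift 1 0)), (c 0 (rshift 1 0)); split.
  apply: contraNT cnz; rewrite negb_or !negbK => /andP[/eqP c1 /eqP c2].
  apply/eqP/rowP => k; rewrite mxE; case: (splitP k) => j; rewrite ord1 => kj.
    by rewrite -c1; congr (c 0 _); apply: val_inj.
  by rewrite -c2; congr (c 0 _); apply: val_inj.
rewrite -LA -[RHS]c0 mulmxA; congr (_ *m _); apply/rowP => i.
rewrite !mxE big_split_ord /= !big_ord1 col_mxEu col_mxEd !mxE.
by congr (_ * _ + _ * _); congr (c 0 _); apply: val_inj.
Qed.
End Dichotomy.

(** * Cycles and components *)

Section Components.
Variables V E : finType.
Implicit Types (G : graph V E) (K : {set V}) (u v : V).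

Lemma adjacentP G u v : reflect
  (exists e, [/\ e \in edges G, u \in ends G e & v \in ends G e]) (adjacent G u v).
Proof.
by apply: (iffP exists_inP) => [[e eG /andP[]]|[e [eG ue ve]]]; exists e;
  rewrite ?ue.
Qed.

Lemma connect_stable (r : rel V) (X : {set V}) u v :
  (forall x y, r x y -> x \in X -> y \in X) -> connect r u v -> u \in X -> v \in X.
Proof.
move=> rX /connectP[p]; elim: p u => [|w p IHp] u /= => [_ -> //|].
by case/andP=> ruw rp lp uX; apply: IHp rp lp (rX _ _ ruw uX).
Qed.

Lemma componentP G K : reflect
  (exists2 u, u \in vertices G
     & K = [set v in vertices G | connect (adjacent G) u v]) (K \in components G).
Proof. exact: imsetP. Qed.

Lemma card_components1P G : (#|components G| == 1)%N <->
  (exists u, u \in vertices G) /\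
  {in vertices G &, forall u v, connect (adjacent G) u v}.
Proof.
split=> [/cards1P[K eqK]|[[u0 u0G] con]].
  have clsK u : u \in vertices G ->
      [set v in vertices G | connect (adjacent G) u v] = K.
    by move=> uG; apply/set1P; rewrite -eqK; apply/componentP; exists u.
  split=> [|u v uG vG].
    have /componentP[u uG _] : K \in components G by rewrite eqK set11.
    by exists u.
  have : v \in K by rewrite -(clsK v vG) inE vG connect0.
  by rewrite -(clsK u uG) inE vG.
apply/cards1P; exists (vertices G); apply/setP => K; rewrite in_set1.
have clsG u : u \in vertices G ->
    [set v in vertices G | connect (adjacent G) u v] = vertices G.
  by move=> uG; apply/setP => v; rewrite inE andb_idr // => vG; apply: con.
apply/componentP/eqP => [[u uG ->]|->]; first exact: clsG.
by exists u0; rewrite ?clsG.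
Qed.

Lemma eq_components G G' : vertices G = vertices G' -> edges G = edges G' ->
  ends G = ends G' -> components G = components G'.
Proof.
by rewrite /components /adjacent => -> -> ->.
Qed.

End Components.

Section Cycles.
Variables (V E : finType) (H : graph V E).
Hypothesis edgesH : edges H = [set: E].
Implicit Types (C D I : {set E}) (v : V).

Local Notation Hsub := (edge_subgraph H).

Lemma edges_subgraph D : edges (Hsub D) = D.
Proof. by rewrite /= edgesH setTI. Qed.

Lemma vertices_subgraphP D v :
  reflect (exists2 e, e \in D & v \in ends H e) (v \in vertices (Hsub D)).
Proof. by rewrite /= edgesH setTI; apply: bigcupP. Qed.

Lemma vertices_subgraph_neq0 D : D != set0 -> exists v, v \in vertices (Hsub D).
Proof.
case/set0Pn => e eD; have : e \in edges H by rewrite edgesH inE.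
case/ends_card/andP => /card_gt0P[v ve] _.
by exists v; apply/vertices_subgraphP; exists e.
Qed.

Lemma degree_subgraph D v : degree (Hsub D) v =
  (#|[set e in D | v \in ends H e]| + #|[set e in D | ends H e == [set v]]|)%N.
Proof.
rewrite /degree /loops edges_subgraph /=.
by congr addn; apply: eq_card => e; rewrite !inE.
Qed.

(** Handshake count: an edge contributes once at each of its ends, and a loop, having a single end,
    once more through [loops]. *)
Lemma sum_degree D :
  (\sum_(v in vertices (Hsub D)) degree (Hsub D) v = 2 * #|D|)%N.
Proof.
transitivity (\sum_v \sum_(e in D) ((v \in ends H e) + (ends H e == [set v])))%N.
  rewrite [RHS](bigID (mem (vertices (Hsub D)))) /= [X in (_ + X)%N]big1 ?addn0.
    apply: eq_bigr => v _; rewrite degree_subgraph big_split /=.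
    rewrite -!sum1_card; congr addn; rewrite [RHS]big_mkcond [LHS]big_mkcond;
      by apply: eq_bigr => e _; rewrite !inE; case: (e \in D) => //=; case: ifP.
  move=> v vD; apply: big1 => e eD.
  have ve : v \notin ends H e.
    by apply: contraNN vD => ve; apply/vertices_subgraphP; exists e.
  rewrite (negbTE ve); case: eqP => // eqe.
  by rewrite eqe set11 in ve.
rewrite exchange_big /= mulnC -sum_nat_const; apply: eq_bigr => e _.
have : e \in edges H by rewrite edgesH inE.
rewrite big_split /= => /ends_card.
rewrite (_ : \sum_i (i \in ends H e) = #|ends H e|)%N; last first.
  by rewrite -sum1_card [RHS]big_mkcond; apply: eq_bigr => v _; case: ifP.
have [/cards1P[u eqe] _|] := boolP (#|ends H e| == 1)%N.
  rewrite eqe cards1 (bigD1 u) //= eqxx big1 // => v vu.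
  by rewrite (inj_eq set1_inj) eq_sym (negbTE vu).
move=> e1 /andP[e_gt0 e_le2]; rewrite big1 => [|v _]; first by lia.
by have [eqe|//] := eqVneq (ends H e) [set v]; rewrite eqe cards1 in e1.
Qed.

Lemma cycle_ofP C : cycle_of H C <->
  #|components (Hsub C)| = 1%N /\
  {in vertices (Hsub C), forall v, degree (Hsub C) v = 2}.
Proof. by split=> [[_ ? ?]|[? ?]]; split; rewrite // edgesH subsetT. Qed.

Lemma cycle_neq0 C : cycle_of H C -> C != set0.
Proof.
case/cycle_ofP => /eqP/card_components1P[[v]].
by case/vertices_subgraphP => e eC _ _ _; apply/set0Pn; exists e.
Qed.

(** Moves the cycles of [H[I]], in terms of which representations are defined, to [H] itself. The
    two subgraphs on [C] agree in vertices, edges and ends without being convertible records, hence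
    the comparison field by field. *)
Lemma cycle_of_subgraph I C :
  cycle_of (Hsub I) C <-> C \subset I /\ cycle_of H C.
Proof.
have esE : C \subset I -> edges (edge_subgraph (Hsub I) C) = edges (Hsub C).
  by move=> CI; rewrite /= edgesH !setTI; apply/setIidPr.
have vsE : C \subset I -> vertices (edge_subgraph (Hsub I) C) = vertices (Hsub C).
  by move=> CI; apply: eq_bigl => e; have /setP/(_ e) := esE CI.
have degE (CI : C \subset I) v : degree (edge_subgraph (Hsub I) C) v = degree (Hsub C) v.
  by rewrite /degree /loops (esE CI).
split=> [[CI cC dC]|[CI [_ cC dC]]].
  rewrite edges_subgraph in CI; split=> //; apply/cycle_ofP; split.
    by rewrite -cC; congr #|pred_of_set _|; apply: eq_components; rewrite ?vsE ?esE.
  by move=> v; rewrite -(degE CI) -vsE //; apply: dC.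
split; first by rewrite edges_subgraph.
  by rewrite -cC; congr #|pred_of_set _|; apply: eq_components; rewrite ?vsE ?esE.
by move=> v; rewrite (degE CI) vsE //; apply: dC.
Qed.

Lemma card_cycle C : cycle_of H C -> #|C| = #|vertices (Hsub C)|.
Proof.
case/cycle_ofP => _ dC; have := sum_degree C.
rewrite (eq_bigr (fun=> 2%N)) => [|v vC]; last exact: dC.
by rewrite sum_nat_const mulnC => /eqP; rewrite eqn_pmul2l // => /eqP.
Qed.

(* The double count of edge ends forces every degree to be exactly 2. *)
Lemma cycle_of_min_degree D : #|components (Hsub D)| = 1%N ->
  {in vertices (Hsub D), forall v, (2 <= degree (Hsub D) v)%N} ->
  (#|D| <= #|vertices (Hsub D)|)%N -> cycle_of H D.
Proof.
move=> cD dD leD; apply/cycle_ofP; split=> // v vD.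
have [] := leqif_sum (fun v (vD : v \in vertices (Hsub D)) => leqif_eq (dD v vD)).
rewrite sum_nat_const sum_degree mulnC leq_pmul2l // eqn_pmul2l // => geD.
rewrite eqn_leq geD leD => /esym/forall_inP/(_ v vD).
by rewrite eq_sym => /eqP.
Qed.

(** At a vertex of [D] the degree in [C] is only 2, so [D] already contains every edge of [C] there;
    connectedness of [C] then spreads [D] over all of [C]. *)
Lemma cycle_of_sub_min_degree C D : cycle_of H C -> D \subset C -> D != set0 ->
  {in vertices (Hsub D), forall v, (2 <= degree (Hsub D) v)%N} -> D = C.
Proof.
case/cycle_ofP => /eqP/card_components1P[_ con] dC DC D0 dD.
have vDC v : v \in vertices (Hsub D) -> v \in vertices (Hsub C).
  case/vertices_subgraphP => e eD ve; apply/vertices_subgraphP; exists e => //.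
  exact: (subsetP DC).
have inD v e : v \in vertices (Hsub D) -> e \in C -> v \in ends H e -> e \in D.
  move=> vD eC ve; have := dD v vD; have := dC v (vDC v vD).
  rewrite !degree_subgraph => dCv dDv.
  have sub1 : [set f in D | v \in ends H f] \subset [set f in C | v \in ends H f].
    by apply/subsetP => f; rewrite !inE => /andP[/(subsetP DC)-> ->].
  have sub2 : [set f in D | ends H f == [set v]]
      \subset [set f in C | ends H f == [set v]].
    by apply/subsetP => f; rewrite !inE => /andP[/(subsetP DC)-> ->].
  have := subset_leq_card sub2; have le1 := subset_leq_card sub1 => le2.
  have /eqP eqDC : [set f in D | v \in ends H f] == [set f in C | v \in ends H f].
    by rewrite eqEcard sub1 /=; lia.
  have : e \in [set f in C | v \in ends H f] by rewrite inE eC.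
  by rewrite -eqDC inE => /andP[].
apply/eqP; rewrite eqEsubset DC; apply/subsetP => e eC.
have [u uD] := vertices_subgraph_neq0 D0.
have : e \in edges H by rewrite edgesH inE.
case/ends_card/andP => /card_gt0P[v ve] _.
have vC : v \in vertices (Hsub C) by apply/vertices_subgraphP; exists e.
apply: (inD v) => //; apply: connect_stable (con u v (vDC u uD) vC) uD => x y.
case/adjacentP => f; rewrite edges_subgraph => -[fC xf yf] xD.
by apply/vertices_subgraphP; exists f; rewrite // (inD x).
Qed.

(* Growing X from the vertices of D to K one vertex at a time adds an edge at
   each step. *)
Lemma excess_component I D K : K \in components (Hsub I) ->
  D \subset edges (induced (Hsub I) K) -> D != set0 ->
  (#|D| + #|vertices (induced (Hsub I) K)|
     <= #|edges (induced (Hsub I) K)| + #|vertices (Hsub D)|)%N.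
Proof.
move=> /componentP[u0 u0I Kdef] DK D0.
pose ins (X : {set V}) := [set e in I | ends H e \subset X].
have KI : K \subset vertices (Hsub I).
  by rewrite Kdef; apply/subsetP => v; rewrite inE => /andP[].
have -> : vertices (induced (Hsub I) K) = K by apply/setIidPr.
have -> : edges (induced (Hsub I) K) = ins K.
  by apply/setP => e; rewrite !inE edgesH inE.
have VD : vertices (Hsub D) \subset K.
  apply/subsetP => v /vertices_subgraphP[e /(subsetP DK)].
  by rewrite !inE => /andP[_ /subsetP eK] /eK.
(* The growth is expressed by a maximal [X] that satisfies the desired inequality with [X] in place
   of [K]. *)
pose P (X : {set V}) := [&& vertices (Hsub D) \subset X, X \subset K
  & (#|D| + #|X| <= #|ins X| + #|vertices (Hsub D)|)%N].
have PD : P (vertices (Hsub D)).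
  rewrite /P subxx VD leq_add2r; apply: subset_leq_card; apply/subsetP => e eD.
  have:= subsetP DK e eD; rewrite !inE edgesH inE /= => /andP[-> _] /=.
  by apply/subsetP => v ve; apply/vertices_subgraphP; exists e.
have [X /maxsetP[/and3P[DX XK leX] maxX] _] := maxset_exists PD.
suff -> : K = X by [].
apply/eqP; rewrite eqEsubset XK andbT; apply/subsetP => v vK.
have [u uD] := vertices_subgraph_neq0 D0.
have uK := subsetP VD u uD.
have sadj : connect_sym (adjacent (Hsub I)).
  by apply: sym_connect_sym => x y; apply: eq_existsb => e; rewrite andbA andbAC -andbA.
have cuv : connect (adjacent (Hsub I)) u v.
  move: uK vK; rewrite Kdef !inE => /andP[_ cu] /andP[_].
  by apply: connect_trans; rewrite sadj.
apply: connect_stable cuv (subsetP DX u uD) => x y.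
case/adjacentP => e; rewrite edges_subgraph => -[eI xe ye] xX.
apply/negPn/negP => yX.
(* The edge [e] leaves [X], so it is not a loop. *)
have eE : ends H e = [set x; y].
  apply/eqP; rewrite eq_sym eqEcard; apply/andP; split.
    by apply/subsetP => z; rewrite !inE => /orP[] /eqP->.
  have : e \in edges H by rewrite edgesH inE.
  case/ends_card/andP => _ /leq_trans; apply.
  by rewrite cards2; case: eqP yX => // <-; rewrite xX.
have yI : y \in vertices (Hsub I) by apply/vertices_subgraphP; exists e.
have yK : y \in K.
  move: (subsetP XK x xX); rewrite Kdef !inE /= => /andP[_ cx].
  rewrite [y \in _]yI; apply: connect_trans cx (connect1 _).
  by apply/adjacentP; exists e; rewrite edges_subgraph.
(* Adding [y] costs one vertex and gains at least the edge [e], so [P] is preserved, against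
   maximality. *)
have : y |: X = X.
  apply: maxX; last exact: subsetUr.
  apply/and3P; split; first exact: subset_trans DX (subsetUr _ _).
    by rewrite subUset sub1set yK.
  rewrite cardsU1 yX addnCA add1n.
  apply: leq_ltn_trans leX _; rewrite ltn_add2r; apply: proper_card.
  apply/properP; split.
    apply/subsetP => f; rewrite !inE => /andP[-> /subset_trans->] //.
    exact: subsetUr.
  exists e; rewrite inE eI /= eE.
    by apply/subsetP => z; rewrite !inE => /orP[] /eqP->; rewrite ?eqxx ?xX ?orbT.
  by apply/subsetPn; exists y; rewrite ?set22.
by move/setP/(_ y); rewrite !inE eqxx (negbTE yX).
Qed.

End Cycles.

(** * Relations of an incidence-like matrix *)

Definition supp (E : finType) (F : fieldType) (l : E -> F) : {set E} :=
  [set e | l e != 0].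

Section IncidenceRelations.
Variables (V E : finType) (H : graph V E) (F : fieldType) (beta : E -> V -> F).
Hypothesis edgesH : edges H = [set: E].
Hypothesis beta_out : forall e v, v \notin ends H e -> beta e v = 0.
Hypothesis beta_in :
  forall e v, v \in ends H e -> ends H e != [set v] -> beta e v != 0.
Implicit Types (l : E -> F) (C D I S : {set E}) (v : V).

Local Notation Hsub := (edge_subgraph H).

Definition is_relation l : Prop := forall v, \sum_e l e * beta e v = 0.

Definition beta_row e : 'rV[F]_#|V| := \row_j beta e (enum_val j).

Definition beta_free S : bool := row_free (rows_mx beta_row S).

Lemma sum_beta_row l : \sum_e l e *: beta_row e = 0 <-> is_relation l.
Proof.
split=> [/rowP l0 v|l0].
  have:= l0 (enum_rank v); rewrite summxE mxE => l0v; rewrite -[RHS]l0v.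
  by apply: eq_bigr => e _; rewrite !mxE enum_rankK.
apply/rowP => j; rewrite summxE mxE -[RHS](l0 (enum_val j)).
by apply: eq_bigr => e _; rewrite !mxE.
Qed.

Lemma beta_freeP S : reflect
  (forall l, is_relation l -> supp l \subset S -> supp l = set0) (beta_free S).
Proof.
apply: (iffP (row_free_rows_mxP _ _)) => [fr l /sum_beta_row l0 lS|fr l lS l0 e].
  apply/setP => e; rewrite !inE; apply/negbF/eqP; apply: fr l0 _ => f lf.
  by apply: (subsetP lS); rewrite inE.
have /setP/(_ e) : supp l = set0.
  apply: fr; first exact/sum_beta_row.
  by apply/subsetP => f; rewrite inE => /lS.
by rewrite !inE => /negbFE/eqP.
Qed.

Lemma minimal_relation S : ~~ beta_free S -> exists l,
  [/\ is_relation l, supp l \subset S, supp l != set0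
    & forall m, is_relation m -> supp m \subset supp l -> supp m != set0 ->
        supp m = supp l].
Proof.
move=> depS; pose P D := ~~ beta_free D.
have [D /minsetP[depD minD] DS] := minset_exists (P := P) depS.
have [l [[e le] lD /sum_beta_row l0]] := exists_rows_relation depD.
have {}lD : supp l \subset D by apply/subsetP => f; rewrite inE => /lD.
have dep m : is_relation m -> supp m != set0 -> P (supp m).
  by move=> m0; apply: contraNN => /beta_freeP->.
have lnz : supp l != set0 by apply/set0Pn; exists e; rewrite inE.
have lE : supp l = D by apply: minD => //; apply: dep.
exists l; split=> // [|m m0 ml mnz]; first by rewrite lE.
by rewrite lE; apply: minD; [apply: dep | rewrite -lE].
Qed.

(** If a single non-loop edge of the support met [v], the equation at [v] would have exactly one
    nonzero term. A loop contributes 2 to the degree by itself. *)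
Lemma degree_supp l : is_relation l ->
  {in vertices (Hsub (supp l)), forall v, (2 <= degree (Hsub (supp l)) v)%N}.
Proof.
move=> l0 v /(vertices_subgraphP edgesH)[e el ve].
rewrite (degree_subgraph edgesH); set A := [set f in _ | v \in _].
set B := [set f in _ | _ == _].
have eA : e \in A by rewrite inE el.
have A0 : (0 < #|A|)%N by apply/card_gt0P; exists e.
have [eqe|neq] := eqVneq (ends H e) [set v].
  have : (0 < #|B|)%N by apply/card_gt0P; exists e; rewrite inE el eqe /=.
  by lia.
suff : (1 < #|A|)%N by lia.
rewrite ltn_neqAle A0 andbT eq_sym; apply/negP => /cards1P[f Af].
have := l0 v; rewrite (bigD1 e) //= big1 ?addr0.
  move/eqP; rewrite mulf_eq0 (negbTE (beta_in ve neq)) orbF.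
  by move: el; rewrite inE => /negbTE->.
move=> g ge; have [vg|/beta_out->] := boolP (v \in ends H g); last exact: mulr0.
suff -> : l g = 0 by rewrite mul0r.
apply/eqP; apply: contraNT ge => lg.
have : g \in A by rewrite !inE lg.
by move: eA; rewrite Af !inE => /eqP-> /eqP->.
Qed.

(** Restricting [l] to the edges inside one component of its support again gives a relation, so
    minimality leaves only one component. *)
Lemma supp_connected l : is_relation l -> supp l != set0 ->
  (forall m, is_relation m -> supp m \subset supp l -> supp m != set0 ->
        supp m = supp l) ->
  #|components (Hsub (supp l))| = 1%N.
Proof.
move=> l0 lnz lmin; apply/eqP/card_components1P.
split=> [|u v uD vD]; first exact: vertices_subgraph_neq0.
pose X := [set x | connect (adjacent (Hsub (supp l))) u x].
have inX e x : l e != 0 -> x \in ends H e -> x \in X -> ends H e \subset X.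
  move=> le xe; rewrite inE => ux; apply/subsetP => y ye; rewrite inE.
  apply: connect_trans ux (connect1 _); apply/adjacentP; exists e.
  by rewrite (edges_subgraph edgesH) inE.
pose m e := if ends H e \subset X then l e else 0.
have m0 : is_relation m.
  move=> x; have [xX|xX] := boolP (x \in X).
    rewrite -[RHS](l0 x); apply: eq_bigr => e _; rewrite /m; case: ifPn => // eX.
    have [xe|/beta_out->] := boolP (x \in ends H e); last by rewrite !mulr0.
    rewrite mul0r; have [->|le] := eqVneq (l e) 0; first by rewrite mul0r.
    by rewrite (inX e x) in eX.
  apply: big1 => e _; rewrite /m; case: ifPn => [eX|_]; last exact: mul0r.
  rewrite beta_out ?mulr0 //; apply: contraNN xX; exact: (subsetP eX).
have ml : supp m \subset supp l.
  by apply/subsetP => e; rewrite !inE /m; case: ifP => // _; rewrite eqxx.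
have mnz : supp m != set0.
  have [e el ue] := vertices_subgraphP edgesH _ _ uD.
  apply/set0Pn; exists e; rewrite inE in el; rewrite inE /m.
  by rewrite (inX e u) // inE connect0.
have [e el ve] := vertices_subgraphP edgesH _ _ vD.
have : e \in supp m by rewrite (lmin m).
rewrite inE /m; case: ifP => [/subsetP/(_ v ve) vX _|_]; last by rewrite eqxx.
by rewrite inE in vX.
Qed.

(** A component with more edges than vertices carries a relation, by counting equations. Conversely,
    on a dependent set a minimal relation has connected support of minimum degree 2; the component
    bound and [excess_component] leave it no more edges than vertices, so it is a cycle, and
    minimality makes it balanced. *)
Lemma frame_of_beta (N : matroid E) :
  (forall I, indep N I = beta_free I) -> frame_representation H N.
Proof.
move=> NE I _; split=> [indI|[noC leK]].
  split=> [C /(cycle_of_subgraph edgesH)[CI _]|K KI].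
    by apply/negP => /minsetP[/negP[]]; apply: indepS CI indI.
  rewrite leqNgt; apply/negP => ltK.
  have [l [[e le] lK l0]] := exists_relation beta ltK.
  have KE : vertices (induced (Hsub I) K) = K.
    case/componentP: KI => u _ ->; apply/setIidPr.
    by apply/subsetP => v; rewrite inE => /andP[].
  rewrite KE in l0.
  rewrite NE in indI; have /setP/(_ e) : supp l = set0.
    apply: (beta_freeP _ indI) => [v|].
      have [/l0//|vK] := boolP (v \in K).
      (* At a vertex outside [K] the equation is trivial, since the edges carrying [l] have all
         their ends in [K]. *)
      apply: big1 => f _; have [->|/lK] := eqVneq (l f) 0; first exact: mul0r.
      rewrite !inE => /andP[_ fK]; rewrite beta_out ?mulr0 //.
      by apply: contraNN vK; apply: (subsetP fK).
    by apply/subsetP => f; rewrite inE => /lK; rewrite !inE => /andP[/andP[]].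
  by rewrite !inE le.
rewrite NE; apply/negPn/negP => /minimal_relation[l [l0 lI lnz lmin]].
have con := supp_connected l0 lnz lmin.
have [_ con'] := (card_components1P _).1 (introT eqP con).
have [u uD] := vertices_subgraph_neq0 edgesH lnz.
have sub v : v \in vertices (Hsub (supp l)) -> v \in vertices (Hsub I).
  case/(vertices_subgraphP edgesH) => e /(subsetP lI) eI ve.
  by apply/(vertices_subgraphP edgesH); exists e.
pose K := [set v in vertices (Hsub I) | connect (adjacent (Hsub I)) u v].
have KI : K \in components (Hsub I) by apply/componentP; exists u; rewrite ?sub.
have lK : supp l \subset edges (induced (Hsub I) K).
  apply/subsetP => e el; rewrite inE (edges_subgraph edgesH) (subsetP lI) //=.
  apply/subsetP => v ve; have vD : v \in vertices (Hsub (supp l)).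
    by apply/(vertices_subgraphP edgesH); exists e.
  rewrite inE sub //=; apply: connect_sub (con' u v uD vD) => x y.
  case/adjacentP => f; rewrite (edges_subgraph edgesH) => -[fl xf yf].
  apply/connect1/adjacentP; exists f.
  by rewrite (edges_subgraph edgesH) (subsetP lI).
have cyc : cycle_of H (supp l).
  apply: cycle_of_min_degree => //; first exact: degree_supp.
  have := excess_component edgesH KI lK lnz.
  by have := leK K KI; lia.
have : circuit N (supp l).
  apply/minsetP; split=> [|D].
    by rewrite NE; apply: contraNN lnz => /beta_freeP->.
  rewrite NE => /minimal_relation[m [m0 mD mnz _]] Dl.
  apply/eqP; rewrite eqEsubset Dl -(lmin m) //; exact: subset_trans Dl.
by apply/negP; apply: noC; apply/(cycle_of_subgraph edgesH).
Qed.

(** * Elementary lifts of the cycle matroid *)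

Section Lift.
Variable y : V -> F.
Hypothesis y_neq0 : forall v, v \in vertices H -> y v != 0.
Hypothesis y_beta : forall e, \sum_(v in vertices H) y v * beta e v = 0.

(* The equation at t is redundant: y combines all of them to 0. *)
Lemma relation_drop_vertex l t : t \in vertices H ->
  (forall v, v != t -> \sum_e l e * beta e v = 0) -> is_relation l.
Proof.
move=> tH l0 v; have [->|/l0//] := eqVneq v t; apply/eqP.
rewrite -(mulrI_eq0 _ (lregP (y_neq0 tH))).
have : \sum_(v in vertices H) y v * \sum_e l e * beta e v = 0.
  under eq_bigr do rewrite mulr_sumr.
  rewrite exchange_big /= big1 // => e _.
  under eq_bigr do rewrite mulrCA.
  by rewrite -mulr_sumr y_beta mulr0.
rewrite (bigD1 t) //= [X in _ + X]big1 => [|u /andP[_ /l0->]]; last exact: mulr0.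
by rewrite addr0 => ->.
Qed.

(** Dropping the equation at one vertex [t] leaves fewer equations than edges of [D]. The vertices
    are counted in a larger [S] so that [D] may be [S] with an edge removed. *)
Lemma exists_sub_relation S D : D \subset S -> D != set0 ->
  (#|vertices (Hsub S)| <= #|D|)%N ->
  exists l, [/\ is_relation l, supp l \subset D & supp l != set0].
Proof.
move=> DS Dnz leSD; have [t tD] := vertices_subgraph_neq0 edgesH Dnz.
have tS : t \in vertices (Hsub S).
  case/(vertices_subgraphP edgesH): tD => e /(subsetP DS) eS te.
  by apply/(vertices_subgraphP edgesH); exists e.
have ltSD : (#|vertices (Hsub S) :\ t| < #|D|)%N.
  by rewrite (cardsD1 t) tS in leSD.
have [l [[e le] lD l0]] := exists_relation beta ltSD.
exists l; split; last by apply/set0Pn; exists e; rewrite inE.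
  apply: (@relation_drop_vertex _ t) => [|v vt].
    case/(vertices_subgraphP edgesH): tD => f _; apply: subsetP.
    by apply: ends_sub; rewrite edgesH inE.
  have [vS|vS] := boolP (v \in vertices (Hsub S)); first by rewrite l0 // !inE vt.
  apply: big1 => f _; have [->|/lD fD] := eqVneq (l f) 0; first exact: mul0r.
  rewrite beta_out ?mulr0 //; apply: contraNN vS => vf.
  by apply/(vertices_subgraphP edgesH); exists f; rewrite // (subsetP DS).
by apply/subsetP => f; rewrite inE => /lD.
Qed.

Lemma cycle_relation C : cycle_of H C -> exists2 l, is_relation l & supp l = C.
Proof.
move=> cC; have [|l [l0 lC lnz]] := exists_sub_relation (subxx C) (cycle_neq0 edgesH cC).
  by rewrite -card_cycle.
exists l => //; apply: cycle_of_sub_min_degree cC _ _ _ => //.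
exact: degree_supp.
Qed.

(** A minimal support with more edges than vertices would still carry a relation after deletion of
    an edge; so it has no such excess, and its degrees make it a cycle. *)
Lemma relation_cycle l : is_relation l -> supp l != set0 ->
  exists2 C : {set E}, C \subset supp l & cycle_of H C.
Proof.
move=> l0 lnz; have /minimal_relation[m [m0 ml mnz mmin]] : ~~ beta_free (supp l).
  by apply: contraNN lnz => /beta_freeP->.
exists (supp m) => //; apply: cycle_of_min_degree => //.
- exact: supp_connected.
- exact: degree_supp.
rewrite leqNgt; apply/negP => ltm; case/set0Pn: (mnz) => e em.
have cme : #|supp m| = #|supp m :\ e|.+1 by rewrite (cardsD1 e) em.
have mem : supp m :\ e != set0.
  rewrite -card_gt0; have [v vm] := vertices_subgraph_neq0 edgesH mnz.
  have : (0 < #|vertices (Hsub (supp m))|)%N by apply/card_gt0P; exists v.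
  by lia.
have [|k [k0 kme knz]] := exists_sub_relation (subsetDl _ [set e]) mem.
  by lia.
have kE : supp k = supp m by apply: mmin => //; apply: subset_trans kme (subsetDl _ _).
by move: kme; rewrite kE => /subsetP/(_ e em); rewrite !inE eqxx.
Qed.

(** Cycles are the minimal supports of relations of [beta], and two such relations always combine
    into one of [a]. Two distinct cycles would thus make a set dependent; conversely, a dependent
    set with only one cycle has its relation of [a] supported on that cycle, which is then
    balanced. *)
Lemma lifted_of_beta (N : matroid E) n (a : E -> 'rV[F]_n) :
  (forall I, indep N I = row_free (rows_mx a I)) ->
  (forall l, \sum_e l e *: a e = 0 -> is_relation l) ->
  (forall l1 l2, is_relation l1 -> is_relation l2 -> exists c1 c2 : F,
     (c1 != 0) || (c2 != 0) /\ \sum_e (c1 * l1 e + c2 * l2 e) *: a e = 0) ->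
  lifted_graphic_representation H N.
Proof.
move=> aN aR codim1 I _.
have dep l D : \sum_e l e *: a e = 0 -> supp l != set0 -> supp l \subset D ->
    ~~ indep N D.
  move=> l0 /set0Pn[e le] lD; rewrite aN; apply/negP => /row_free_rows_mxP.
  move/(_ l)=> fr; move: le; rewrite inE fr ?eqxx // => f lf.
  by apply: (subsetP lD); rewrite inE.
have depE D : ~~ indep N D -> exists l,
    [/\ \sum_e l e *: a e = 0, supp l != set0 & supp l \subset D].
  rewrite aN => /exists_rows_relation[l [[e le] lD l0]]; exists l; split=> //.
    by apply/set0Pn; exists e; rewrite inE.
  by apply/subsetP => f; rewrite inE => /lD.
split=> [indI|[uniqC noC]].
  split=> [C D|C] /(cycle_of_subgraph edgesH)[CI cC]; last first.
    by apply/negP => /minsetP[/negP[]]; apply: indepS CI indI.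
  case/(cycle_of_subgraph edgesH) => DI cD.
  have [l1 l10 l1E] := cycle_relation cC; have [l2 l20 l2E] := cycle_relation cD.
  have [c1 [c2 [cnz c0]]] := codim1 l1 l2 l10 l20.
  pose k e := c1 * l1 e + c2 * l2 e.
  have k0 e : k e = 0.
    apply/eqP/negPn/negP => ke; suff : ~~ indep N I by rewrite indI.
    apply: (dep k) => //; first by apply/set0Pn; exists e; rewrite inE.
    apply/subsetP => f; rewrite inE => kf; apply: contraTT kf => fI.
    rewrite negbK /k; have := contraNN (subsetP CI f) fI.
    have := contraNN (subsetP DI f) fI.
    rewrite -l1E -l2E !inE !negbK => /eqP-> /eqP->.
    by rewrite !mulr0 addr0.
  have prop e : (c1 * l1 e == 0) = (c2 * l2 e == 0).
    by have /eqP := k0 e; rewrite addr_eq0 => /eqP->; rewrite oppr_eq0.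
  have lnz : forall l : E -> F, forall B, supp l = B -> cycle_of H B ->
      exists e, l e != 0.
    move=> l B lB /(cycle_neq0 edgesH)/set0Pn[e]; rewrite -lB inE => le.
    by exists e.
  (* If just one coefficient vanished, [k = 0] would force the other cycle's relation to be zero.
     With both nonzero, [k = 0] equates the supports. *)
  have c12 : (c1 == 0) = (c2 == 0).
    apply/idP/idP => /eqP cz.
      have [e le] := lnz _ _ l2E cD; have := prop e.
      by rewrite cz mul0r eqxx mulf_eq0 (negbTE le) orbF => <-.
    have [e le] := lnz _ _ l1E cC; have := prop e.
    by rewrite cz mul0r eqxx mulf_eq0 (negbTE le) orbF => ->.
  have c2nz : c2 == 0 = false by move: cnz; rewrite c12 orbb => /negbTE.
  rewrite -l1E -l2E; apply/setP => e; rewrite !inE; congr negb.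
  by have := prop e; rewrite !mulf_eq0 c12 c2nz.
apply/negPn/negP => /depE[l [l0 lnz lI]].
have [C Cl cC] := relation_cycle (aR l l0) lnz.
have [m m0 mE] := cycle_relation cC.
have CI : C \subset I by apply: subset_trans Cl lI.
have cCI : cycle_of (Hsub I) C by apply/(cycle_of_subgraph edgesH).
have /set0Pn[e0 e0C] := cycle_neq0 edgesH cC.
have me0 : m e0 != 0 by move: e0C; rewrite -mE inE.
(* The multiple of the cycle relation [m] that cancels [l] at [e0], an edge of the unique cycle
   [C]. *)
pose c := l e0 / m e0; pose k e := l e - c * m e.
have kR : is_relation k.
  move=> v; under eq_bigr do rewrite mulrBl -mulrA.
  by rewrite sumrB -mulr_sumr (aR l l0 v) (m0 v) mulr0 subr0.
have k00 : k e0 = 0 by rewrite /k /c divfK ?subrr.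
have kl : supp k \subset supp l.
  apply/subsetP => e; rewrite !inE; apply: contraNN => /eqP le.
  rewrite /k le; suff -> : m e = 0 by rewrite mulr0 subr0.
  apply/eqP/negPn/negP => me; have : e \in supp l by apply: (subsetP Cl); rewrite -mE inE.
  by rewrite inE le eqxx.
have kz : supp k = set0.
  (* A cycle in the support of [k] would have to be [C], but [e0] is not in that support. *)
  apply/eqP/negPn/negP => /(relation_cycle kR)[D Dk cD].
  have DE : D = C.
    apply: uniqC => //; apply/(cycle_of_subgraph edgesH); split=> //.
    by apply: subset_trans Dk (subset_trans kl lI).
  by move: e0C; rewrite -DE => /(subsetP Dk); rewrite inE k00 eqxx.
have lC : supp l \subset C.
  apply/subsetP => e; rewrite -mE !inE; apply: contraNN => /eqP me.
  have /setP/(_ e) := kz; rewrite !inE /k me mulr0 subr0 => /negbFE.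
  by [].
(* [C] is dependent because it supports [l]. A dependent subset of [C] carries a relation whose
   support has minimum degree 2 and so is all of [C]; hence [C] is a circuit. *)
move/negP: (noC C cCI); apply; apply/minsetP; split=> [|D /depE[k' [k'0 k'nz k'D]] DC].
  exact: dep l0 lnz lC.
apply/eqP; rewrite eqEsubset DC.
have <- // : supp k' = C.
apply: cycle_of_sub_min_degree cC _ _ _ => //; first exact: subset_trans k'D DC.
exact: degree_supp (aR _ k'0).
Qed.

End Lift.
End IncidenceRelations.

Local Notation "x %:F" := (FracField.tofrac x) : ring_scope.

(** * Generic functionals over the field of rational functions *)

Section GenericFunctionals.
Variables (V E : finType) (H : graph V E).
Variables (F : fieldType) (n : nat) (a : E -> 'rV[F]_n).

Definition avoid v : {set E} := edges (del_vertices H [set v]).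

(* Its value at [a e] is a polynomial whose coefficients are the values of a
   spanning set of the functionals vanishing on [avoid v], so that it is nonzero
   as soon as one of them is. *)
Definition generic_functional v : 'cV[{fraction {poly F}}]_n :=
  \col_i (rVpoly (row i (cokermx (rows_mx a (avoid v)))))%:F.

Definition generic_vector e : 'rV[{fraction {poly F}}]_n :=
  map_mx (@FracField.tofrac _ \o polyC) (a e).

(** The pairing is the polynomial with coefficient vector [a e *m cokermx _], which is zero only if
    the vector is. One functional thus serves all edges at [v] simultaneously, even when [F] is too
    small to contain suitable coefficients. *)
Lemma generic_functional_eq0 e v :
  ((generic_vector e *m generic_functional v) 0 0 == 0)
    = (a e <= rows_mx a (avoid v))%MS.
Proof.
rewrite submxE mxE; set C := cokermx _.
have -> : \sum_j generic_vector e 0 j * generic_functional v j 0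
    = (rVpoly (a e *m C))%:F.
  rewrite mulmx_sum_row !raddf_sum; apply: eq_bigr => j _.
  by rewrite !mxE /= -tofracM linearZ /= mul_polyC.
rewrite tofrac_eq0; apply/eqP/eqP => [p0|->]; last exact: raddf0.
by rewrite -[LHS]rVpolyK p0 raddf0.
Qed.
End GenericFunctionals.

(** * From frameworks to frame and lifted-graphic representations *)

Lemma connected_component_vertices (V E : finType) (H : graph V E) :
  graph_connected 2 H -> vertices H != set0 ->
  vertices H \in components H /\
  {in vertices H &, forall u v, connect (adjacent H) u v}.
Proof.
move=> con2 Hnz; have : #|components H| = 1%N.
  rewrite -(con2 set0) ?cards0 ?proper0 //; congr #|pred_of_set _|.
  apply: eq_components => //=; rewrite setC0 ?setIT //.
  by apply/setP => e; rewrite inE subsetT andbT.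
move/eqP/card_components1P => [_ con]; split=> //.
have [u uH] := set0Pn _ Hnz; apply/componentP; exists u => //.
by apply/setP => v; rewrite inE andb_idr // => vH; apply: con.
Qed.

Theorem theorem4p5 (V E : finType) (H : graph V E) (N : matroid E) :
  graph_connected 2 H -> framework H N ->
  matroid_connected N 3 -> representable N ->
  frame_representation H N \/ lifted_graphic_representation H N.
Proof.
move=> con2 [edgesH qg2 qg3 _] _ [F [n [a0 a0N]]].
have aN I : indep N I = row_free (rows_mx a0 I).
  by rewrite -free_rows_mx; apply/idP/idP => /a0N.
pose a := generic_vector a0; pose w := generic_functional H a0.
have gN I : indep N I = row_free (rows_mx a I).
  by rewrite aN -(row_free_map_rows (@FracField.tofrac _ \o polyC)).
pose beta e v := (a e *m w v) 0 0.
have avoidE e v : (e \in avoid H v) = (v \notin ends H e).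
  by rewrite inE edgesH inE subsetC sub1set inE.
have beta_out e v : v \notin ends H e -> beta e v = 0.
  move=> ve; apply/eqP; rewrite /beta generic_functional_eq0.
  by rewrite row_rows_mx // avoidE.
have endsV e : ends H e \subset vertices H by apply: ends_sub; rewrite edgesH inE.
have beta_in e v : v \in ends H e -> ends H e != [set v] -> beta e v != 0.
  move=> ve nle; rewrite /beta generic_functional_eq0.
  (* A zero value would put [e] in the closure of the edges avoiding [v], whereas (QG3) admits
     there, among the edges at [v], only loops. *)
  apply/negP => /(closure_span aN)/(subsetP (qg3 v (subsetP (endsV e) v ve))).
  by rewrite inE -/(avoid H v) avoidE ve inE edgesH inE (negbTE nle).
have aR l : \sum_e l e *: a e = 0 -> is_relation beta l.
  move=> l0 v; have -> : \sum_e l e * beta e v = ((\sum_e l e *: a e) *m w v) 0 0.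
    by rewrite mulmx_suml summxE; apply: eq_bigr => e _; rewrite -scalemxAl mxE.
  by rewrite l0 mul0mx mxE.
have rank_le : (\rank (rows_mx a setT) <= #|vertices H|)%N.
  (* Without vertices there are no edges, since every edge has an end; otherwise [H] is its own only
     component and (QG2) applies to it. *)
  rewrite -(rank_rows_mx gN); have [H0|Hnz] := eqVneq (vertices H) set0.
    apply/bigmax_leqP => I _; rewrite H0 cards0 leqn0 cards_eq0.
    apply/eqP/setP => e; rewrite in_set0; apply/negbTE/negP => _.
    have : e \in edges H by rewrite edgesH inE.
    case/ends_card/andP; rewrite card_gt0 => /set0Pn[v /(subsetP (endsV e))].
    by rewrite H0 inE.
  have [/qg2 + _] := connected_component_vertices con2 Hnz.
  rewrite /= setIid; congr (rank N _ <= _)%N.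
  by apply/setP => e; rewrite !inE edgesH inE endsV.
have null_zero (y : V -> _) :
    (forall e, \sum_(v in vertices H) y v * beta e v = 0) ->
    forall u v, u \in vertices H -> v \in vertices H -> y u = 0 -> y v = 0.
  move=> y0 u v uH vH yu.
  have Hnz : vertices H != set0 by apply/set0Pn; exists u.
  have [_ /(_ u v uH vH) cuv] := connected_component_vertices con2 Hnz.
  suff : v \in [set x | y x == 0] by rewrite inE => /eqP.
  (* The equation of a non-loop edge has just two terms, at its two ends, so a zero of [y] passes
     from one end to the other, and along paths. *)
  apply: (connect_stable _ cuv); last by rewrite inE yu.
  move=> x z /adjacentP[e [_ xe ze]]; rewrite !inE => /eqP yx.
  have [<-|zx] := eqVneq x z; first by rewrite yx.
  have eE : ends H e = [set x; z].
    apply/eqP; rewrite eq_sym eqEcard subUset !sub1set xe ze /= cards2 zx.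
    have : e \in edges H by rewrite edgesH inE.
    by case/ends_card/andP.
  have := y0 e; rewrite (bigD1 z) ?(subsetP (endsV e)) //= big1 ?addr0.
    move/eqP; rewrite mulf_eq0 (negbTE (beta_in _ _ ze _)) ?orbF //.
    by apply: contraNneq zx => ez; move: xe; rewrite ez inE.
  move=> t /andP[_ tz]; have [->|tx] := eqVneq t x; first by rewrite yx mul0r.
  by rewrite beta_out ?mulr0 // eE !inE negb_or tx.
have [eqR|[[y ynz y0] codim1]] := relation_dichotomy rank_le null_zero; [left|right].
  apply: (frame_of_beta edgesH beta_out beta_in) => I.
  (* By [aR] and [eqR], [a] and [beta] have the same relations, hence the same independent sets. *)
  rewrite gN; apply/row_free_rows_mxP/beta_freeP => [fr l l0 lI|fr l lI l0 e].
    apply/setP => e; rewrite !inE fr ?eqxx //; last by apply: eqR => v _; apply: l0.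
    by move=> f lf; apply: (subsetP lI); rewrite inE.
  have /setP/(_ e) : supp l = set0.
    apply: fr; first exact: aR.
    by apply/subsetP => f; rewrite inE => /lI.
  by rewrite !inE => /negbFE/eqP.
apply: (lifted_of_beta edgesH beta_out beta_in ynz y0 gN aR) => l1 l2 l10 l20.
by apply: codim1 => v _; [apply: l10 | apply: l20].
Qed.
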